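(* Let $V$ and $W_1,\dots,W_J$ be real Hilbert spaces, $B_j\colon V\to W_j$ bounded linear operators, $G_j\colon W_j\to\overline{\mathbb{R}}$ proper, convex, and lower semicontinuous functions ($1\le j\le J$), and $F\colon V\to\mathbb{R}$ a Fr\'echet differentiable convex function that is strongly convex and smooth. Let $0<\tau<1$. Consider the primal problem $$\min_{v\in V}\Big\{F(v)+\sum_{j=1}^JG_j(B_jv)\Big\}\qquad(\mathrm{P})$$ and its dual problem $$\min_{q_j\in W_j^*}\Big\{F^*\Big(-\sum_{j=1}^JB_j^*q_j\Big)+\sum_{j=1}^JG_j^*(q_j)\Big\}.\qquad(\mathrm{D})$$ The dualization-based Douglas--Rachford splitting algorithm for (P): choose $u^{(0)}\in V$ and $(r_1^{(0)},\dots,r_J^{(0)})\in(V^* )^J$, and for $n=0,1,2,\dots$ set $\hat{u}^{(n+1,0)}=u^{(n)}$; for $j=1,2,\dots,J$ successively set $$\hat{u}^{(n+1,j)}=\arg\min_{v\in V}\Big\{D_F(v;\hat{u}^{(n+1,j-1)})+(r_j^{(n)},v)+G_j(B_jv)\Big\},$$ $$r_j^{(n+1)}=r_j^{(n)}+\tau\big(F'(\hat{u}^{(n+1,j)})-F'(\hat{u}^{(n+1,j-1)})\big);$$ and then set $$u^{(n+1)}=(F^* )'\Big(\sum_{j=1}^Jr_j^{(n+1)}\Big),$$ is a dualization of the relaxed successive subspace correction method (relaxed SSC) for (D): choose $(p_1^{(0)},\dots,p_J^{(0)})\in\prod_{j=1}^JW_j^*$, and for $n=0,1,2,\dots$ take,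 for $j=1,\dots,J$ successively, $$\hat{p}_j^{(n+1)}\in\arg\min_{q_j\in W_j^*}\Big\{F^*\Big(-B_j^*q_j-\sum_{i=1}^{j-1}B_i^*\hat{p}_i^{(n+1)}-\sum_{i=j+1}^JB_i^*p_i^{(n)}\Big)+G_j^*(q_j)\Big\},$$ and then $p_j^{(n+1)}=(1-\tau)p_j^{(n)}+\tau\hat{p}_j^{(n+1)}$, $1\le j\le J$. More precisely, if $$u^{(0)}=(F^* )'\Big(-\sum_{j=1}^JB_j^*p_j^{(0)}\Big),\quad r_j^{(0)}=-B_j^*p_j^{(0)},\quad 1\le j\le J,$$ then $$u^{(n)}=(F^* )'\Big(-\sum_{j=1}^JB_j^*p_j^{(n)}\Big),\quad r_j^{(n)}=-B_j^*p_j^{(n)},\quad 1\le j\le J,\ n\ge1.$$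
   Context: Notation: $\overline{\mathbb{R}}=\mathbb{R}\cup\{\pm\infty\}$; $V^*$, $W_j^*$ are dual spaces; $(\cdot,\cdot)$ denotes inner products and duality pairings; $B_j^*\colon W_j^*\to V^*$ is the adjoint. The conjugate is $F^*(q)=\sup_{v\in V}\{(q,v)-F(v)\}$, $q\in V^*$; similarly $G_j^*$ on $W_j^*$. The Bregman divergence is $D_F(v;w)=F(v)-F(w)-(F'(w),v-w)$. $F$ strongly convex: for some $\mu>0$, $F(v)\ge F(w)+(F'(w),v-w)+\frac{\mu}{2}\|v-w\|^2$ for all $v,w\in V$. $F$ smooth: for some $L>0$, $\|F'(v)-F'(w)\|\le L\|v-w\|$ for all $v,w\in V$. Under these assumptions $F'\colon V\to V^*$ is invertible with inverse $(F^* )'\colon V^*\to V$. Dualization (definition): a method $\{u^{(n)}\}$ for (P) is a dualization of a method $\{(p_1^{(n)},\dots,p_J^{(n)})\}$ for (D) if, for any initial configuration of the dual algorithm, there exists an initial configuration of the primal algorithm such that $-\sum_{j=1}^JB_j^*p_j^{(n)}\in\partial F(u^{(n)})=\{F'(u^{(n)})\}$ for all $n\ge1$. Standing assumptions: every minimization subproblem defining an iterate through an $\arg\min$ admits a solution; and whenever Fenchel--Rockafellar duality is used (for (P)/(D) and for the corresponding pairs of local subproblems), the strong duality qualification condition holds: for a problem $\min_{v}\{\Phi(v)+\Gamma(Bv)\}$, the function $w\mapsto\inf_{v}\{\Phi(v)+\Gamma(Bv+w)\}$ is subdifferentiable (has nonempty subdifferential) at $w=0$. *)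

(* Defs.v *)
From HB Require Import structures.
From mathcomp Require Import all_boot all_order all_algebra.
From mathcomp Require Import all_classical all_reals all_analysis.

Set Implicit Arguments.
Unset Strict Implicit.
Unset Printing Implicit Defensive.
Import Order.TTheory GRing.Theory Num.Theory.
Import numFieldNormedType.Exports.

Local Open Scope classical_set_scope.
Local Open Scope ring_scope.

Definition hilbert_space (R : realType) (V : completeNormedModType R) : Prop :=
  exists ip : {dot V for idfun}, forall x : V, `|x| ^+ 2 = ip x x.

Section BoundedLinear.
Variables (R : realType) (V W : normedModType R).

Definition blin_pred : {pred V -> W} :=
  [pred f : V -> W | `[< linear f /\ continuous f >]].

Lemma blin_pred_submod : submod_closed blin_pred.
Proof.
split=> [|a f g].
  rewrite inE; split; last exact: cst_continuous.
  by move=> k x y; rewrite /= scaler0 addr0.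
rewrite !inE => -[lf cf] [lg cg]; split.
  move=> k x y; rewrite !fctE lf lg !scalerDr !scalerA [a * k]mulrC.
  by rewrite addrACA.
move=> x; apply: cvgD; last exact: cg.
by apply: cvgZ; [exact: cvg_cst|exact: cf].
Qed.

HB.instance Definition _ :=
  GRing.isSubmodClosed.Build R (V -> W) blin_pred blin_pred_submod.

Record blin := Blin {blin_fun :> V -> W ; _ : blin_fun \in blin_pred}.

HB.instance Definition _ := [isSub for blin_fun].
HB.instance Definition _ := [Choice of blin by <:].
HB.instance Definition _ := [SubChoice_isSubLmodule of blin by <:].

Lemma blin_linear (f : blin) : linear f.
Proof. by case: f => f /= /[!inE] -[]. Qed.

Lemma blin_continuous (f : blin) : continuous f.
Proof. by case: f => f /= /[!inE] -[]. Qed.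

HB.instance Definition _ (f : blin) :=
  GRing.isLinear.Build R V W *:%R f (blin_linear f).

Lemma blinP (f g : blin) : (forall x, f x = g x) -> f = g.
Proof. by move=> fg; apply/val_inj/funext. Qed.

Definition opnorm (f : blin) : R := sup [set `|f x| | x in [set x | `|x| <= 1]].

Lemma opnorm_has_sup (f : blin) :
  has_sup [set `|f x| | x in [set x | `|x| <= 1]].
Proof.
split; first by exists `|f 0|, 0 => //=; rewrite normr0 ler01.
have /linear_boundedP : bounded_near f (nbhs 0).
  by apply/linear_bounded_continuous; exact: blin_continuous.
move=> /pinfty_ex_gt0[M M0 fM]; exists M => _ [x /= x1 <-].
by rewrite (le_trans (fM x))// ler_piMr// ltW.
Qed.

Lemma opnorm_ub (f : blin) x : `|x| <= 1 -> `|f x| <= opnorm f.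
Proof.
move=> x1; apply: sup_upper_bound; first exact: opnorm_has_sup.
by exists x.
Qed.

Lemma opnorm_ge0 (f : blin) : 0 <= opnorm f.
Proof.
by rewrite (le_trans _ (@opnorm_ub f 0 _)) ?normr0 ?ler01.
Qed.

Lemma opnorm_lub (f : blin) M :
  (forall x, `|x| <= 1 -> `|f x| <= M) -> opnorm f <= M.
Proof.
move=> fM; apply: sup_le_ub; first by have [] := opnorm_has_sup f.
by move=> _ [x /= x1 <-]; exact: fM.
Qed.

Lemma opnormP (f : blin) x : `|f x| <= opnorm f * `|x|.
Proof.
have [->|x0] := eqVneq x 0; first by rewrite linear0 !normr0 mulr0.
have nx : 0 < `|x| by rewrite normr_gt0.
rewrite -ler_pdivrMr//.
have := @opnorm_ub f (`|x|^-1 *: x).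
rewrite linearZ/= !normrZ normfV normr_id mulVf ?gt_eqF// lexx.
by rewrite mulrC => /(_ isT).
Qed.

Lemma opnormD (f g : blin) : opnorm (f + g) <= opnorm f + opnorm g.
Proof.
apply: opnorm_lub => x x1; rewrite (le_trans (ler_normD _ _))//.
by rewrite lerD// opnorm_ub.
Qed.

Lemma opnormZ_le (a : R) (f : blin) : opnorm (a *: f) <= `|a| * opnorm f.
Proof.
apply: opnorm_lub => x x1.
by rewrite [X in `|X|](_ : _ = a *: f x)// normrZ ler_wpM2l// opnorm_ub.
Qed.

Lemma opnormZ (a : R) (f : blin) : opnorm (a *: f) = `|a| * opnorm f.
Proof.
apply/eqP; rewrite eq_le opnormZ_le/=.
have [->|a0] := eqVneq a 0; first by rewrite normr0 mul0r opnorm_ge0.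
have := opnormZ_le a^-1 (a *: f).
rewrite scalerA mulVf// scale1r normfV.
by rewrite -ler_pdivrMl ?invr_gt0 ?normr_gt0// invrK.
Qed.

Lemma opnorm0_eq0 (f : blin) : opnorm f = 0 -> f = 0.
Proof.
move=> f0; apply: blinP => x; apply/eqP.
by rewrite -normr_le0 (le_trans (opnormP f x))// f0 mul0r.
Qed.

HB.instance Definition _ :=
  Lmodule_isNormed.Build R blin opnormD opnormZ opnorm0_eq0.

End BoundedLinear.

Notation dual V := (blin V (GRing.regular _)).

Section Adjoint.
Variables (R : realType) (V W : normedModType R).

Lemma adjoint_subproof (B : blin V W) (q : dual W) :
  (q \o B : V -> R^o) \in @blin_pred R V R^o.
Proof.
rewrite inE; split; first by move=> a x y /=; rewrite !linearP.
by move=> x; apply: continuous_comp; exact: blin_continuous.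
Qed.

Definition adjoint (B : blin V W) (q : dual W) : dual V :=
  Blin (adjoint_subproof B q).

End Adjoint.

Section ConvexAnalysis.
Variables (R : realType) (X : normedModType R).
Implicit Types (f : X -> \bar R) (F : X -> R).

Definition eproper f : Prop :=
  (forall x, f x != -oo%E) /\ (exists x, f x < +oo)%E.

(* To be used for functions that do not take the value -oo, so that the
   right-hand side is never of the form +oo - oo. *)
Definition econvex f : Prop := forall (t : R) x y, 0 < t < 1 ->
  (f (t *: x + (1 - t) *: y)%R <= t%:E * f x + (1 - t)%:E * f y)%E.

Definition subdifferential f (x : X) : set (dual X) :=
  [set xi : dual X | forall y, (f x + (xi (y - x)%R)%:E <= f y)%E].

Definition conjugate f (q : dual X) : \bar R :=
  ereal_sup [set ((q x)%:E - f x)%E | x in [set: X]].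

(* The Fréchet derivative as an element of the dual space
   (0 at points of non-differentiability). *)
Definition fderiv F (x : X) : dual X :=
  insubd (0 : dual X) ('d (F : X -> R^o) x : X -> R^o).

Lemma fderivE F x : differentiable (F : X -> R^o) x ->
  fderiv F x = 'd (F : X -> R^o) x :> (X -> R^o).
Proof.
move=> dF; rewrite /fderiv -[LHS]/(val _) val_insubd ifT// inE; split.
  exact: linearP.
exact: diff_continuous.
Qed.

Definition strongly_convex F : Prop := exists2 mu : R, 0 < mu &
  forall v w, F w + fderiv F w (v - w) + mu / 2 * `|v - w| ^+ 2 <= F v.

Definition smooth F : Prop := exists2 L : R, 0 < L &
  forall v w, `|fderiv F v - fderiv F w| <= L * `|v - w|.

Definition bregman F (v w : X) : R := F v - F w - fderiv F w (v - w).

End ConvexAnalysis.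

(* The derivative of the conjugate of F, with values in X: the Fréchet
   derivative of the conjugate at q is a functional on [dual X], identified with
   the element of X that represents it by evaluation.  The conjugate of a
   strongly convex F is finite everywhere, so [fine] does not lose
   information. *)
Definition conj_deriv (R : realType) (X : normedModType R) (F : X -> R)
    (q : dual X) : X :=
  let Fs : dual X -> R^o := fine \o conjugate (EFin \o F) in
  xget 0 [set v | differentiable Fs q /\
                    forall xi : dual X, fderiv Fs q xi = xi v].

Definition argmin (R : realType) (T : Type) (f : T -> \bar R) : set T :=
  [set x | forall y, (f x <= f y)%E].

Section Qualification.
Variables (R : realType) (V : normedModType R).
Local Open Scope ereal_scope.

Definition perturbation (W : normedModType R) (B : blin V W)
    (Phi : V -> R) (Gam : W -> \bar R) (w : W) : \bar R :=
  ereal_inf [set (Phi v)%:E + Gam (B v + w)%R | v in [set: V]].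

Definition strong_duality_qualification (W : normedModType R) (B : blin V W)
    (Phi : V -> R) (Gam : W -> \bar R) : Prop :=
  subdifferential (perturbation B Phi Gam) 0%R !=set0.

Variables (J : nat) (W : 'I_J -> normedModType R).

(* The same condition for min_v Phi v + \sum_j Gam_j (B_j v): the perturbation
   ranges over the product of the W_j, whose dual is the product of the duals. *)
Definition perturbation_prod (B : forall j, blin V (W j)) (Phi : V -> R)
    (Gam : forall j, W j -> \bar R) (w : forall j, W j) : \bar R :=
  ereal_inf [set (Phi v)%:E + \sum_(j < J) Gam j (B j v + w j)%R
            | v in [set: V]].

Definition strong_duality_qualification_prod (B : forall j, blin V (W j))
    (Phi : V -> R) (Gam : forall j, W j -> \bar R) : Prop :=
  exists xi : forall j, dual (W j), forall w : forall j, W j,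
    perturbation_prod B Phi Gam (fun=> 0%R) + (\sum_(j < J) xi j (w j))%:E
      <= perturbation_prod B Phi Gam w.

End Qualification.

Section Algorithms.
Variables (R : realType) (V : normedModType R).
Variables (J : nat) (W : 'I_J -> normedModType R).
Variables (F : V -> R) (G : forall j, W j -> \bar R).
Variables (B : forall j, blin V (W j)) (tau : R).

Definition adjoint_sum (q : forall j, dual (W j)) : dual V :=
  \sum_(j < J) adjoint (B j) (q j).

Definition DR_smooth_part (w : V) (rj : dual V) (v : V) : R :=
  bregman F v w + rj v.

Definition DR_objective (j : 'I_J) (w : V) (rj : dual V) (v : V) : \bar R :=
  ((DR_smooth_part w rj v)%:E + G (B j v))%E.

(* [uhat n.+1 k], 0 <= k <= J, is \hat u^{(n+1,k)}; since the index j : 'I_J is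
   0-based, step j goes from [uhat n.+1 j] to [uhat n.+1 j.+1].
   [uhat 0] is not used. *)
Definition DR_run (u : nat -> V) (r : nat -> 'I_J -> dual V)
    (uhat : nat -> nat -> V) : Prop :=
  forall n : nat,
    [/\ uhat n.+1 0%N = u n,
        forall j : 'I_J,
          argmin (DR_objective j (uhat n.+1 j) (r n j)) (uhat n.+1 j.+1),
        forall j : 'I_J, r n.+1 j =
          r n j + tau *: (fderiv F (uhat n.+1 j.+1) - fderiv F (uhat n.+1 j)) &
        u n.+1 = conj_deriv F (\sum_(j < J) r n.+1 j)].

Definition SSC_objective (j : 'I_J) (phat p : forall i, dual (W i))
    (qj : dual (W j)) : \bar R :=
  (conjugate (EFin \o F)
     (- adjoint (B j) qj
      - \sum_(i < J | (i < j)%N) adjoint (B i) (phat i)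
      - \sum_(i < J | (j < i)%N) adjoint (B i) (p i))%R
   + conjugate (@G j) qj)%E.

(* [phat n.+1 j] is \hat p_j^{(n+1)}; [phat 0] is not used. *)
Definition SSC_run (p phat : nat -> forall j, dual (W j)) : Prop :=
  forall n : nat, forall j : 'I_J,
    argmin (SSC_objective (phat n.+1) (p n)) (phat n.+1 j) /\
    p n.+1 j = (1 - tau) *: p n j + tau *: phat n.+1 j.

(* A method is given by the relation between its initial configurations and the
   sequences it may generate. *)
Definition DR_method (c : V * ('I_J -> dual V)) (u : nat -> V) : Prop :=
  exists r uhat, [/\ u 0%N = c.1, r 0%N = c.2 & DR_run u r uhat].

Definition SSC_method (c : forall j, dual (W j))
    (p : nat -> forall j, dual (W j)) : Prop :=
  exists phat, p 0%N = c /\ SSC_run p phat.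

(* The first conjunct prevents [c'] from being a configuration from which the
   primal method generates no sequence at all. *)
Definition is_dualization (Cprimal Cdual : Type)
    (primal : Cprimal -> (nat -> V) -> Prop)
    (dualm : Cdual -> (nat -> forall j, dual (W j)) -> Prop) : Prop :=
  forall c : Cdual, exists c' : Cprimal,
    (exists u, primal c' u) /\
    forall p u, dualm c p -> primal c' u -> forall n : nat, (1 <= n)%N ->
      subdifferential (EFin \o F) (u n) (- adjoint_sum (p n)) /\
      subdifferential (EFin \o F) (u n) = [set fderiv F (u n)].

Definition coupled (p : forall j, dual (W j)) (u : V) (r : 'I_J -> dual V) :
    Prop :=
  u = conj_deriv F (- adjoint_sum p) /\
  forall j, r j = - adjoint (B j) (p j).

End Algorithms.

(* Main.v *)
Require Import Defs.
From HB Require Import structures.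
From mathcomp Require Import all_boot all_order all_algebra.
From mathcomp Require Import all_classical all_reals all_analysis.
From mathcomp Require Import ring lra.

Set Implicit Arguments.
Unset Strict Implicit.
Unset Printing Implicit Defensive.
Import Order.TTheory GRing.Theory Num.Theory.
Import numFieldNormedType.Exports.

Local Open Scope classical_set_scope.
Local Open Scope ring_scope.

(** Strong convexity and smoothness make F' : V -> V^* a bijection whose inverse
    is the derivative of F^*.  So a primal iterate v can be replaced by the dual
    vector F'(v), and coupling the two methods means matching F'(v) with a sum
    of vectors - B_i^* q_i.

    In these terms one sweep of the splitting reads as follows.  Suppose that
    before step j the current point w satisfies
    F'(w) = - (sum over i of B_i^* q_i), where q_i is the updated phat_i for
    i < j and the old p_i for i >= j, and that r_j = - B_j^* p_j.  The smooth
    part of the subproblem in v is then, up to a constant, F(v) - a(v) with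
    a = F'(w) - r_j: subtracting r_j removes the contribution of the old p_j,
    and the conjugate of the smooth part at - B_j^* q is F^*(a - B_j^* q) up to
    a constant.  Hence the subproblem solved by the correction method in block
    j is exactly the Fenchel-Rockafellar dual of the subproblem solved by the
    splitting method.  Strong duality makes the optimal values opposite, so
    the primal solution u and the dual solution phat_j are linked by the
    extremality relation a - B_j^* phat_j = F'(u) ([dual_argmin_subgradient],
    [DR_step_fderiv]): the invariant holds with phat_j in place of p_j.  The
    relaxation is linear, so the update of r_j preserves r_j = - B_j^* p_j
    ([coupledS]), and summing over j gives the new u.

    The analytic input is the inversion of F'.  Surjectivity comes from
    minimizing F - q, whose minimizing sequences are Cauchy by strong convexity
    ([attained_conjugate]); the identity F' = q at the minimizer is obtained
    from smoothness by an elementary estimate ([fderiv_unique]).  The conjugate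
    is differentiable because its first-order remainder is bounded by
    |p - q|^2 / (2 mu) ([conjugate_remainder]). *)

(** * Bounded linear maps *)

Section BlinTheory.
Variables (R : realType) (V W : normedModType R).
Implicit Types f g : blin V W.

Lemma blinDE f g x : (f + g) x = f x + g x. Proof. by []. Qed.

Lemma blinNE f x : (- f) x = - f x. Proof. by []. Qed.

Lemma blin_normP f x : `|f x| <= `|f| * `|x|. Proof. exact: opnormP. Qed.

Lemma adjointE (B : blin V W) (q : dual W) x : adjoint B q x = q (B x).
Proof. by []. Qed.

Lemma adjointD (B : blin V W) (p q : dual W) :
  adjoint B (p + q) = adjoint B p + adjoint B q.
Proof. exact/blinP. Qed.

Lemma adjointZ (B : blin V W) (a : R) (q : dual W) :
  adjoint B (a *: q) = a *: adjoint B q.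
Proof. exact/blinP. Qed.

End BlinTheory.

(** * The derivative of a strongly convex and smooth function *)

Lemma le_of_small_slope (R : realFieldType) (a b c : R) :
  (forall t, 0 < t -> a <= b + c * t) -> a <= b.
Proof.
move=> h; apply/ler_addgt0Pr => e e0.
pose d := `|c| + 1; have d0 : 0 < d by rewrite ltr_wpDl.
have t0 : 0 < e / d by rewrite divr_gt0.
apply: (le_trans (h _ t0)); rewrite lerD2l mulrA ler_pdivrMr// mulrC.
by rewrite ler_pM2l// (le_trans (ler_norm c))// lerDl.
Qed.

Section StronglyConvexSmooth.
Variables (R : realType) (V : completeNormedModType R) (F : V -> R).
Hypothesis F_diff : forall v, differentiable (F : V -> R^o) v.
Hypothesis F_strong : strongly_convex F.
Hypothesis F_smooth : smooth F.

Lemma fderiv_convex v w : F w + fderiv F w (v - w) <= F v.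
Proof.
have [mu mu0 /(_ v w)] := F_strong; apply: le_trans.
by rewrite lerDl mulr_ge0 ?sqr_ge0// divr_ge0// ltW.
Qed.

(** A subgradient xi at x and the gradient at x + t h are compared through
    t xi(h) <= F(x + t h) - F(x) <= t F'(x + t h)(h); the Lipschitz bound on F'
    then lets t tend to 0 and gives xi(h) <= F'(x)(h), with equality because h
    may be replaced by - h. *)
Lemma fderiv_unique (x : V) (xi : dual V) :
  (forall y, F x + xi (y - x) <= F y) -> fderiv F x = xi.
Proof.
move=> xiF; have [L L0 FL] := F_smooth.
have pos (h : V) : xi h <= fderiv F x h.
  apply: (@le_of_small_slope _ _ _ (L * `|h| ^+ 2)) => t t0.
  have /= h1 := xiF (x + t *: h).
  have /= h2 := fderiv_convex x (x + t *: h).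
  have e1 : x + t *: h - x = t *: h by rewrite addrAC subrr add0r.
  have e2 : x - (x + t *: h) = - (t *: h) by rewrite opprD addrA subrr add0r.
  rewrite e1 linearZ /= in h1; rewrite e2 linearN linearZ /= in h2.
  have h4 := blin_normP (fderiv F (x + t *: h) - fderiv F x) h.
  have h5 := FL (x + t *: h) x; rewrite e1 normrZ (gtr0_norm t0) in h5.
  rewrite blinDE blinNE in h4.
  have h6 := le_trans (ler_norm _) h4.
  have h7 := le_trans h6 (ler_wpM2r (normr_ge0 h) h5).
  have h8 : xi h <= fderiv F (x + t *: h) h.
    rewrite -(ler_pM2l t0) -(lerD2l (F x)); apply: (le_trans h1).
    by rewrite -lerBlDr.
  apply: (le_trans h8); rewrite -lerBlDl; apply: (le_trans h7).
  by rewrite le_eqVlt (_ : L * _ * _ = L * `|h| ^+ 2 * t) ?eqxx//; ring.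
apply: blinP => h; apply: le_anti; rewrite pos andbT.
by have := pos (- h); rewrite !linearN /= lerN2.
Qed.

(** A strongly convex differentiable function supplies enough functionals to
    separate points: if neither F'(v) nor F'(w) distinguishes v from w, strong
    convexity at w and at v gives F(w) + c <= F(v) and F(v) + c <= F(w) with
    c = mu/2 |v - w|^2. *)
Lemma dual_separates (v w : V) : (forall xi : dual V, xi v = xi w) -> v = w.
Proof.
move=> vw; have [mu mu0 Fmu] := F_strong.
apply/eqP; rewrite -subr_eq0 -normr_le0.
have d0 (xi : dual V) : xi (v - w) = 0 by rewrite linearB /= vw subrr.
have d0' (xi : dual V) : xi (w - v) = 0 by rewrite linearB /= vw subrr.
have h1 := Fmu v w; have h2 := Fmu w v.
rewrite d0 addr0 in h1; rewrite d0' addr0 distrC in h2.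
rewrite leNgt; apply/negP => n0.
have A0 : 0 < mu / 2 * `|v - w| ^+ 2 by rewrite mulr_gt0 ?divr_gt0 ?exprn_gt0.
have := lt_le_trans (ltr_pwDr A0 (lexx _)) (le_trans (lerD h1 (lexx _)) h2).
by rewrite ltNge lerDl ltW.
Qed.

Lemma subdifferential_fderiv x :
  subdifferential (EFin \o F) x = [set fderiv F x].
Proof.
apply/seteqP; split => [xi /= hxi|_ /= -> y /=].
  by apply/esym/fderiv_unique => y; have := hxi y; rewrite /= -EFinD lee_fin.
by rewrite -EFinD lee_fin fderiv_convex.
Qed.

(** The supremum defining F^*(q) is attained.  Strong convexity at the midpoint
    of v and w gives, for phi = F - q and any lower bound m of phi,
    mu/4 |v - w|^2 <= phi(v) + phi(w) - 2 m, so minimizing sequences are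
    Cauchy. *)
Lemma attained_conjugate (q : dual V) :
  exists x, forall y, F x - q x <= F y - q y.
Proof.
have [mu mu0 Fmu] := F_strong.
pose phi v := F v - q v.
have phi_strong (v w : V) :
    phi w + (fderiv F w - q) (v - w) + mu / 2 * `|v - w| ^+ 2 <= phi v.
  rewrite blinDE blinNE /phi linearB /= [q (v - w)]linearB /=.
  by have := Fmu v w; rewrite linearB /=; lra.
have phi_mid (v w : V) m : (forall x, m <= phi x) ->
    mu / 4 * `|v - w| ^+ 2 <= phi v + phi w - 2 * m.
  move=> hm; pose z := 2^-1 *: (v + w).
  have vz : v - z = 2^-1 *: (v - w).
    rewrite /z scalerDr scalerBr opprD addrA; congr (_ - _).
    by rewrite -[X in X - _]scale1r -scalerBl; congr (_ *: _); lra.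
  have wz : w - z = - (2^-1 *: (v - w)).
    rewrite /z scalerDr scalerBr opprB opprD addrCA addrC.
    congr (_ + _); last first.
    by rewrite -[X in X - _]scale1r -scalerBl; congr (_ *: _); lra.
  have h1 := phi_strong v z; have h2 := phi_strong w z.
  rewrite vz in h1; rewrite wz linearN normrN /= in h2.
  rewrite normrZ gtr0_norm// in h1; rewrite normrZ gtr0_norm// in h2.
  have h3 := hm z.
  move: h1 h2; set N := `|v - w|; set d := blin_fun _ _ => h1 h2.
  have -> : mu / 4 * N ^+ 2 = 2 * (mu / 2 * (2^-1 * N) ^+ 2) by field.
  lra.
pose S := range phi.
have S_lb : has_lbound S.
  pose D := fderiv F 0 - q.
  (* the minimum over v of the quadratic lower bound of phi at 0 *)
  exists (phi 0 - (2 * mu)^-1 * `|D| ^+ 2) => _ [v _ <-].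
  have h := phi_strong v 0; rewrite subr0 -/D in h.
  have h1 := blin_normP D v.
  have h2 : - `|D v| <= D v by rewrite lerNl -normrN ler_norm.
  have h3 : `|D| * `|v| <= (2 * mu)^-1 * `|D| ^+ 2 + mu / 2 * `|v| ^+ 2.
    rewrite -subr_ge0.
    rewrite (_ : _ - _ = (2 * mu)^-1 * (`|D| - mu * `|v|) ^+ 2).
      by rewrite mulr_ge0 ?sqr_ge0// invr_ge0 mulr_ge0// ltW.
    by field; rewrite gt_eqF.
  have h4 := le_trans h1 h3.
  lra.
have S_inf : has_inf S by split => //; exists (phi 0), 0.
pose m := inf S.
have hm x : m <= phi x by apply: ge_inf => //; exists x.
have /choice[x hx] : forall n : nat, exists x, phi x < m + n.+1%:R^-1.
  move=> n; have [|_ [x _ <-] hx] := @inf_adherent _ S n.+1%:R^-1 _ S_inf.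
    by rewrite invr_gt0.
  by exists x.
have x_cauchy : cauchy (x @ \oo).
  apply: cauchy_exP => e e0.
  (* the bound 8 / (mu e^2) makes 2 / (N + 1) smaller than mu e^2 / 4 *)
  have [N hN] : exists N : nat, 8 / (mu * e ^+ 2) < N.+1%:R.
    exists (Num.truncn (8 / (mu * e ^+ 2))).
    exact: truncnS_gt.
  exists (x N); exists N => // n /= Nn.
  rewrite -ball_normE /=.
  have h := phi_mid (x N) (x n) _ hm.
  have h1 := hx N; have h2 := hx n.
  have h3 : n.+1%:R^-1 <= N.+1%:R^-1 :> R by rewrite lef_pV2 ?posrE// ler_nat.
  have me0 : 0 < mu * e ^+ 2 by rewrite mulr_gt0// exprn_gt0.
  have h4 : N.+1%:R^-1 < mu * e ^+ 2 / 8.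
    rewrite -[ltRHS]invrK ltf_pV2 ?posrE ?invr_gt0 ?divr_gt0//.
    by rewrite invfM invrK mulrC.
  have h5 : mu / 4 * `|x N - x n| ^+ 2 < mu / 4 * e ^+ 2.
    move: h h1 h2 h3 h4; clearbody m; clear hm hx.
    move: (phi (x N)) (phi (x n)) m.
    move: (n.+1%:R^-1) (N.+1%:R^-1) (mu / 4 * _) (e ^+ 2).
    clear -R => p q r s a b c; lra.
  rewrite ltr_pM2l ?divr_gt0// in h5.
  by rewrite -(@ltr_pXn2r _ 2)// ?nnegrE// ltW.
have /cauchy_cvgP/cvg_ex[l xl] := x_cauchy.
exists l => y; apply: le_trans (hm y).
have phic : phi (x n) @[n --> \oo] --> phi l.
  apply: cvgB.
    apply: (@cvg_comp _ _ _ x F _ (nbhs l)) => //.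
    exact: differentiable_continuous.
  by apply: (@cvg_comp _ _ _ x q _ (nbhs l)) => //; exact: blin_continuous.
have mc : m + n.+1%:R^-1 @[n --> \oo] --> m + 0.
  by apply: cvgD; [exact: cvg_cst|exact: cvg_harmonic].
rewrite addr0 in mc.
by apply: (ler_cvg_to phic mc); near=> n; exact: ltW.
Unshelve. all: end_near. Qed.

Lemma fderiv_surj (q : dual V) : exists v, fderiv F v = q.
Proof.
have [x hx] := attained_conjugate q; exists x; apply: fderiv_unique => y.
by have := hx y; rewrite linearB /=; lra.
Qed.

End StronglyConvexSmooth.

(** * The derivative of the conjugate *)

Section Evaluation.
Variables (R : realType) (X : normedModType R) (v : X).

(** The canonical image of [v] in the bidual. *)
Definition eval_at (xi : dual X) : R^o := xi v.

Fact eval_at_linear : linear eval_at. Proof. by []. Qed.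

HB.instance Definition _ :=
  GRing.isLinear.Build R (dual X) R^o *:%R eval_at eval_at_linear.

Lemma eval_at_continuous : continuous eval_at.
Proof.
apply: bounded_linear_continuous; exists `|v|; split; first exact: num_real.
move=> M vM; near=> xi; rewrite /= (le_trans (blin_normP xi v))//.
rewrite -[leRHS]mul1r ler_pM//; last exact: ltW.
Unshelve. all: end_near. Qed.

End Evaluation.

Lemma differentiable_of_expansion (R : realType) (X Y : normedModType R)
    (f : X -> Y) (df : {linear X -> Y}) x (C : R) :
  continuous df -> (forall h, `|f (h + x) - f x - df h| <= C * `|h| ^+ 2) ->
  differentiable f x /\ 'd f x = df :> (X -> Y).
Proof.
move=> dfc fC.
have fo : f \o shift x = cst (f x) + df +o_ 0 id.
  apply/eqaddoP => e e0; near=> h.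
  rewrite [X in `|X|](_ : _ = f (h + x) - f x - df h); last first.
    by rewrite -addrA -opprD.
  apply: (le_trans (fC h)); rewrite expr2 mulrA ler_wpM2r//.
  apply: (@le_trans _ _ ((`|C| + 1) * `|h|)).
    by rewrite ler_wpM2r// (le_trans (ler_norm C))// lerDl.
  have C0 : 0 < `|C| + 1 by rewrite ltr_wpDl.
  rewrite mulrC -ler_pdivlMr//; near: h.
  by apply: nbhs0_le; rewrite divr_gt0.
have dE := diff_unique dfc fo.
split => //; apply/diff_locallyP; split; first by rewrite dE.
by rewrite dE.
Unshelve. all: end_near. Qed.

(** The case of equality in the Fenchel-Young inequality. *)
Lemma conjugate_subgradient (R : realType) (X : normedModType R) (F : X -> R)
    (x : X) (q : dual X) : (forall y, F x + q (y - x) <= F y) ->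
  conjugate (EFin \o F) q = (q x - F x)%:E.
Proof.
move=> qF; apply/eqP; rewrite eq_le; apply/andP; split.
  apply: ge_ereal_sup => _ [y _ <-]; rewrite -EFinB lee_fin.
  by have := qF y; rewrite linearB /= lerBrDr; lra.
by apply: ereal_sup_ubound; exists x.
Qed.

Section ConjugateDerivative.
Variables (R : realType) (V : completeNormedModType R) (F : V -> R).
Hypothesis F_diff : forall v, differentiable (F : V -> R^o) v.
Hypothesis F_strong : strongly_convex F.
Hypothesis F_smooth : smooth F.

Lemma conjugate_fderiv v :
  conjugate (EFin \o F) (fderiv F v) = (fderiv F v v - F v)%:E.
Proof. by apply: conjugate_subgradient => y; exact: fderiv_convex. Qed.

(** The first-order remainder of F^* at q = F'(v), evaluated at p = F'(x).
    Convexity at x makes it nonnegative; strong convexity at v bounds it by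
    |p - q| d - mu/2 d^2 with d = |x - v|, and maximizing over d leaves
    |p - q|^2 / (2 mu). *)
Lemma conjugate_remainder (mu : R) (v x : V) (p q : dual V) : 0 < mu ->
  F x + p (v - x) <= F v -> F v + q (x - v) + mu / 2 * `|x - v| ^+ 2 <= F x ->
  `|(p x - F x) - (q v - F v) - (p - q) v| <= (2 * mu)^-1 * `|p - q| ^+ 2.
Proof.
move=> mu0 hp hq.
have hpq := le_trans (ler_norm _) (blin_normP (p - q) (x - v)).
have pE : p (x - v) = p x - p v by rewrite linearB.
have pE' : p (v - x) = p v - p x by rewrite linearB.
have qE : q (x - v) = q x - q v by rewrite linearB.
rewrite blinDE blinNE pE qE in hpq; rewrite pE' in hp; rewrite qE in hq.
rewrite blinDE blinNE.
move: hp hq hpq; set N := `|p - q|; set d := `|x - v|.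
have : N * d <= (2 * mu)^-1 * N ^+ 2 + mu / 2 * d ^+ 2.
  rewrite -subr_ge0 (_ : _ - _ = (2 * mu)^-1 * (N - mu * d) ^+ 2).
    by rewrite mulr_ge0 ?sqr_ge0// invr_ge0 mulr_ge0// ltW.
  by field; rewrite gt_eqF.
have : 0 <= (2 * mu)^-1 * N ^+ 2.
  by rewrite mulr_ge0 ?sqr_ge0// invr_ge0 mulr_ge0// ltW.
move: (_ * N ^+ 2) (_ * d ^+ 2) (N * d) (p x) (p v) (q x) (q v) (F x) (F v).
clear -R => A D ND px pv qx qv Fx Fv *.
by rewrite ler_norml; apply/andP; split; lra.
Qed.

(** Every point of the dual is F'(x) for some x, so the remainder estimate
    shows that F^* is differentiable at F'(v) with derivative the evaluation
    at v; v is the only vector representing this functional. *)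
Lemma conj_deriv_fderiv v : conj_deriv F (fderiv F v) = v.
Proof.
have [mu mu0 Fmu] := F_strong.
set q := fderiv F v; pose Fs : dual V -> R^o := fine \o conjugate (EFin \o F).
have FsE w : Fs (fderiv F w) = fderiv F w w - F w.
  by rewrite /Fs/= conjugate_fderiv.
have [Fs_diff dFs] : differentiable Fs q /\ 'd Fs q = eval_at v :> (_ -> _).
  apply: (@differentiable_of_expansion _ _ _ _ _ _ (2 * mu)^-1).
    exact: eval_at_continuous.
  move=> h; have [x hx] := fderiv_surj F_diff F_strong F_smooth (h + q).
  have hE : h = fderiv F x - q by rewrite hx addrK.
  rewrite -hx (FsE x) (FsE v) hE.
  have hp := fderiv_convex F_strong v x.
  exact: (conjugate_remainder mu0 hp (Fmu x v)).
apply: xget_unique => [|w [_ hw]].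
  by split=> // xi; rewrite fderivE// dFs.
by apply: (dual_separates F_strong) => xi; rewrite -hw fderivE// dFs.
Qed.

Lemma fderiv_conj_deriv q : fderiv F (conj_deriv F q) = q.
Proof.
have [v <-] := fderiv_surj F_diff F_strong F_smooth q.
by rewrite conj_deriv_fderiv.
Qed.

End ConjugateDerivative.

(** * Fenchel-Rockafellar duality *)

Lemma conjugate_ge (R : realType) (V : normedModType R)
    (f : V -> \bar R) (q : dual V) x :
  ((q x)%:E - f x <= conjugate f q)%E.
Proof. by apply: ereal_sup_ubound; exists x. Qed.

(** The extremality relation between a primal solution u and a dual solution q.
    A subgradient xi of the perturbation function at 0 is a dual point whose
    value is at most the opposite of the primal minimum; hence so is the value
    at q.  Bounding the conjugates at q from below by the Fenchel-Young
    inequality, at an arbitrary v for Phi and at B u for Gam, leaves the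
    subgradient inequality of Phi at u. *)
Lemma dual_argmin_subgradient (R : realType) (V W : normedModType R)
    (B : blin V W) (Phi : V -> R) (Gam : W -> \bar R) (u : V) (q : dual W) :
  eproper Gam -> strong_duality_qualification B Phi Gam ->
  argmin (fun v => (Phi v)%:E + Gam (B v))%E u ->
  argmin (fun s : dual W =>
    conjugate (EFin \o Phi) (- adjoint B s)%R + conjugate Gam s)%E q ->
  forall v, Phi u - q (B (v - u)) <= Phi v.
Proof.
move=> [GN [y0 Gy0]] [xi /= xiP] hu hq v.
have P_le (x : V) (y : W) :
    (perturbation B Phi Gam (y - B x)%R <= (Phi x)%:E + Gam y)%E.
  apply: ereal_inf_lbound; exists x => //.
  by rewrite (addrC (B x)) subrK.
have P0 : ((Phi u)%:E + Gam (B u) <= perturbation B Phi Gam 0%R)%E.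
  by apply: le_ereal_inf_tmp => _ [x _ <-]; rewrite addr0.
have primal_dual (x : V) (y : W) :
    ((Phi u)%:E + Gam (B u) + (xi (y - B x)%R)%:E <= (Phi x)%:E + Gam y)%E.
  apply: le_trans (P_le x y); apply: le_trans (xiP _).
  by rewrite subr0 leeD2r.
(* Gam (B u) is finite: otherwise the perturbation would be +oo at 0, hence
   everywhere, against the existence of y0 in the domain of Gam *)
have [g gE] : exists g, Gam (B u) = g%:E.
  move: (GN (B u)) (primal_dual 0 y0).
  case: (Gam (B u)) => [g _ _||//]; first by exists g.
  by move: (GN y0) Gy0; case: (Gam y0).
rewrite gE in primal_dual.
(* the conjugate of Gam is finite at xi, so the sum of the two suprema below
   can be bounded one supremum at a time *)
have [gs gsE] : exists gs, conjugate Gam xi = gs%:E.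
  have h1 := conjugate_ge Gam xi (B u).
  have h2 : (conjugate Gam xi <= (xi (B u) - g)%:E)%E.
    apply: ge_ereal_sup => _ [y _ <-].
    have := primal_dual u y; have := GN y.
    case: (Gam y) => [z _|_ _|//]; last exact: leNye.
    rewrite -!EFinD !lee_fin linearB /=; lra.
  rewrite gE -EFinB in h1.
  by move: h1 h2; case: (conjugate Gam xi) => [gs _ _||]//; exists gs.
have strong : (conjugate (EFin \o Phi) (- adjoint B xi)%R + conjugate Gam xi
    <= (- (Phi u + g))%:E)%E.
  rewrite gsE -leeBrDr//; apply: ge_ereal_sup => _ [x _ <-].
  rewrite blinNE adjointE /= -!EFinB lee_fin.
  suff : gs <= - (Phi u + g) + xi (B x) + Phi x by lra.
  rewrite -lee_fin -gsE; apply: ge_ereal_sup => _ [y _ <-].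
  have := primal_dual x y; have := GN y.
  case: (Gam y) => [z _|_ _|//]; last exact: leNye.
  by rewrite -!EFinD !lee_fin linearB /=; lra.
have := le_trans (hq xi) strong.
have := leeD (conjugate_ge (EFin \o Phi) (- adjoint B q) v)
  (conjugate_ge Gam q (B u)).
move=> /le_trans /[apply]; rewrite gE -!EFinB -EFinD lee_fin.
rewrite blinNE adjointE [B (v - u)]linearB /= [q (_ - _)]linearB /=; lra.
Qed.

Lemma conjugate_sub_affine (R : realType) (X : normedModType R) (F : X -> R)
    (a s : dual X) (c : R) :
  conjugate (EFin \o (fun x => F x - a x - c)) s =
  (conjugate (EFin \o F) (a + s)%R + c%:E)%E.
Proof.
apply/eqP; rewrite eq_le; apply/andP; split.
  apply: ge_ereal_sup => _ [x _ <-].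
  rewrite -leeBlDr//; apply: le_trans (conjugate_ge _ _ x).
  rewrite blinDE /= -!EFinB lee_fin; lra.
rewrite -leeBrDr//; apply: ge_ereal_sup => _ [x _ <-].
rewrite leeBrDr//; apply: le_trans (conjugate_ge _ _ x).
by rewrite blinDE /= -!EFinB -EFinD lee_fin; lra.
Qed.

(** * One sweep of the two methods *)

(** The update of r_j in terms of b = B_j^* p_j and b' = B_j^* phat_j: the
    contribution s of the other blocks cancels. *)
Lemma relaxed_increment (R : pzRingType) (M : lmodType R) (t : R) (b b' s : M) :
  - b + t *: (- (b' + s) - - (b + s)) = - ((1 - t) *: b + t *: b').
Proof.
have -> : - (b' + s) - - (b + s) = b - b'.
  by rewrite opprK opprD addrC addrA addrAC addrK.
rewrite scalerBr scalerBl scale1r opprD opprB addrCA addrA.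
by congr (_ + _); rewrite addrC.
Qed.

Section Coupling.
Variables (R : realType) (V : completeNormedModType R).
Variables (J : nat) (W : 'I_J -> completeNormedModType R).
Variables (B : forall j, blin V (W j)) (G : forall j, W j -> \bar R).
Variables (F : V -> R) (tau : R).
Hypothesis G_proper : forall j, eproper (@G j).
Hypothesis F_diff : forall v, differentiable (F : V -> R^o) v.
Hypothesis F_strong : strongly_convex F.
Hypothesis F_smooth : smooth F.

(** The blocks of the correction method after its first [k] local solves, before
    relaxation. *)
Definition sweep (phat p : forall i, dual (W i)) (k : nat) :
    forall i, dual (W i) :=
  fun i => if (i < k)%N then phat i else p i.

(** Isolating block j just before (k = j) or just after (k = j + 1) its own
    solve: the other blocks contribute the same sum in both cases. *)
Lemma adjoint_sum_sweep (phat p : forall i, dual (W i)) (j : 'I_J) k :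
  (j <= k <= j.+1)%N ->
  adjoint_sum B (sweep phat p k) =
    adjoint (B j) (sweep phat p k j)
    + (\sum_(i < J | (i < j)%N) adjoint (B i) (phat i)
       + \sum_(i < J | (j < i)%N) adjoint (B i) (p i)).
Proof.
move=> /andP[jk kj]; rewrite /adjoint_sum (bigD1 j)//=; congr (_ + _).
rewrite (bigID (fun i : 'I_J => (i < j)%N))/=; congr (_ + _).
  apply: eq_big => [i|i /andP[_ ij]]; last by rewrite /sweep (leq_trans ij jk).
  case: ltngtP => // ij; rewrite ?andbF ?andbT//.
  by rewrite -(inj_eq val_inj) /= ltn_eqF.
apply: eq_big => [i|i /andP[inj]].
  by rewrite -leqNgt [RHS]ltn_neqAle -(inj_eq val_inj) eq_sym.
rewrite -leqNgt => ji; rewrite /sweep ltnNge (leq_trans kj)//.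
by rewrite ltn_neqAle ji andbT eq_sym; apply: contra inj => /eqP/val_inj->.
Qed.

(** The subproblem of the correction method in block j is the dual of the
    subproblem of the splitting method, so the two solutions are linked by the
    extremality relation. *)
Lemma DR_step_fderiv (j : 'I_J) (w u : V) (phat p : forall i, dual (W i)) :
  let r := - adjoint (B j) (p j) in
  strong_duality_qualification (B j) (DR_smooth_part F w r) (@G j) ->
  argmin (DR_objective F G B j w r) u ->
  argmin (@SSC_objective _ _ _ _ F G B j phat p) (phat j) ->
  fderiv F w = - adjoint_sum B (sweep phat p j) ->
  fderiv F u = - adjoint_sum B (sweep phat p j.+1).
Proof.
move=> r qual hu hp hw.
(* a is the argument of F^* in the dual subproblem, without the term in q_j *)
pose a := - \sum_(i < J | (i < j)%N) adjoint (B i) (phat i)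
          - \sum_(i < J | (j < i)%N) adjoint (B i) (p i).
have aE : a = fderiv F w - r.
  rewrite hw (adjoint_sum_sweep _ _ (j := j)) ?leqnn ?leqnSn//.
  by rewrite /sweep ltnn /r opprK addrC opprD addrA subrr add0r /a opprD.
pose c := F w - fderiv F w w.
have smoothE : DR_smooth_part F w r = fun v => F v - a v - c.
  apply/funext => v; rewrite /DR_smooth_part /bregman aE /c blinDE blinNE.
  by rewrite linearB /=; ring.
have sub : forall v, DR_smooth_part F w r u - phat j (B j (v - u))
    <= DR_smooth_part F w r v.
  apply: (dual_argmin_subgradient (G_proper j) qual hu) => q.
  have := hp q; rewrite /SSC_objective smoothE !conjugate_sub_affine.
  have argE s : - adjoint (B j) s
      - \sum_(i < J | (i < j)%N) adjoint (B i) (phat i)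
      - \sum_(i < J | (j < i)%N) adjoint (B i) (p i) = a - adjoint (B j) s.
    by rewrite -addrA addrC.
  rewrite !argE => h.
  by rewrite ![(_ + c%:E)%E]addeC -!addeA leeD2l.
rewrite (adjoint_sum_sweep _ _ (j := j)) ?leqnn ?leqnSn//.
rewrite {1}/sweep ltnSn opprD [- (_ + _)]opprD -/a addrC.
apply: (fderiv_unique F_strong F_smooth) => v.
have -> : (a - adjoint (B j) (phat j) : dual V) (v - u)
    = (a v - a u) - phat j (B j (v - u)) by rewrite -linearB.
by have := sub v; rewrite smoothE; lra.
Qed.

(** By induction on the number of local solves, F' at each inner iterate is the
    opposite of the adjoint sum of the partly updated blocks.  The increment of
    r_j is tau times the difference of two consecutive such values, which
    differ only in the contribution of block j. *)
Lemma coupledS (p : nat -> forall j, dual (W j)) phat u r uhat n :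
  SSC_run F G B tau p phat -> DR_run F G B tau u r uhat ->
  (forall j : 'I_J, strong_duality_qualification (B j)
    (DR_smooth_part F (uhat n.+1 j) (r n j)) (@G j)) ->
  coupled F B (p n) (u n) (r n) -> coupled F B (p n.+1) (u n.+1) (r n.+1).
Proof.
move=> /(_ n) ssc /(_ n)[uhat0 uhatS rS uS] qual [uE rE].
have sweepE k : (k <= J)%N ->
    fderiv F (uhat n.+1 k) = - adjoint_sum B (sweep (phat n.+1) (p n) k).
  elim: k => [_|k IH kJ]; first by rewrite uhat0 uE fderiv_conj_deriv.
  have := @DR_step_fderiv (Ordinal kJ) (uhat n.+1 k) (uhat n.+1 k.+1)
    (phat n.+1) (p n).
  rewrite -rE /=; apply; [exact: (qual (Ordinal kJ))|
    exact: (uhatS (Ordinal kJ))|by have [] := ssc (Ordinal kJ)|].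
  exact/IH/ltnW.
have rSE j : r n.+1 j = - adjoint (B j) (p n.+1 j).
  have fj := sweepE j (ltnW (ltn_ord j)); have fjS := sweepE j.+1 (ltn_ord j).
  rewrite (adjoint_sum_sweep _ _ (j := j)) ?leqnn ?leqnSn// in fj.
  rewrite (adjoint_sum_sweep _ _ (j := j)) ?leqnn ?leqnSn// in fjS.
  rewrite {1}/sweep ltnn in fj; rewrite {1}/sweep ltnSn in fjS.
  have [_ pS] := ssc j.
  rewrite (rS j) (rE j) fj fjS relaxed_increment pS.
  by rewrite adjointD !adjointZ.
have sumE : \sum_(j < J) r n.+1 j = - adjoint_sum B (p n.+1).
  by rewrite /adjoint_sum -sumrN; apply: eq_bigr => j _; exact: rSE.
rewrite sumE in uS.
exact: (conj uS rSE).
Qed.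

End Coupling.

(** * Existence of splitting iterates *)

Section Existence.
Variables (R : realType) (V : normedModType R).
Variables (J : nat) (W : 'I_J -> normedModType R).
Variables (F : V -> R) (G : forall j, W j -> \bar R).
Variables (B : forall j, blin V (W j)) (tau : R).
Hypothesis solvable : forall (j : 'I_J) (w : V) (rj : dual V),
  argmin (DR_objective F G B j w rj) !=set0.

Lemma DR_run_exists (u0 : V) (r0 : 'I_J -> dual V) :
  exists u r uhat, [/\ u 0%N = u0, r 0%N = r0 & DR_run F G B tau u r uhat].
Proof.
pose sol j w rj := xget 0 (argmin (DR_objective F G B j w rj)).
have solP j w rj : argmin (DR_objective F G B j w rj) (sol j w rj).
  by case: (solvable j w rj) => x hx; exact: xgetI hx.
(* the inner iterates issued from the outer state s = (u, r); beyond J they are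
   stationary *)
pose hat (s : V * ('I_J -> dual V)) : nat -> V :=
  fix hat k := if k is k'.+1 then
    if insub k' is Some j then sol j (hat k') (s.2 j) else hat k'
  else s.1.
pose upd (s : V * ('I_J -> dual V)) (j : 'I_J) :=
  s.2 j + tau *: (fderiv F (hat s j.+1) - fderiv F (hat s j)).
pose next s := (conj_deriv F (\sum_(j < J) upd s j), upd s).
pose st n := iter n next (u0, r0).
(* the inner iterates of step n.+1 start from state n, hence the predecessor *)
exists (fun n => (st n).1), (fun n => (st n).2), (fun n => hat (st n.-1)).
split=> // n; split=> // j; rewrite /= valK; exact: solP.
Qed.

End Existence.

(** * The splitting method as a dualization *)

Theorem theorem5p4 (R : realType) (V : completeNormedModType R)
    (J : nat) (W : 'I_J -> completeNormedModType R)
    (B : forall j, blin V (W j)) (G : forall j, W j -> \bar R)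
    (F : V -> R) (tau : R)
    (hV : hilbert_space V) (hW : forall j, hilbert_space (W j))
    (hG : forall j, [/\ eproper (G j), econvex (G j)
                      & lower_semicontinuous (G j)])
    (F_diff : forall v, differentiable (F : V -> R^o) v)
    (F_convex : convex_function [set: convex_lmodType V]
                  (F : convex_lmodType V -> R^o))
    (F_strong : strongly_convex F) (F_smooth : smooth F)
    (htau : 0 < tau < 1)
    (* the argmin subproblems of the primal method admit solutions *)
    (hsolv : forall (j : 'I_J) (w : V) (rj : dual V),
      argmin (DR_objective F G B j w rj) !=set0)
    (* strong duality qualification for (P)/(D) *)
    (hqual : strong_duality_qualification_prod B F G)
    (* strong duality qualification for the pairs of local subproblems *)
    (hqual_loc : forall (p phat : nat -> forall j, dual (W j))
        (u : nat -> V) (r : nat -> 'I_J -> dual V) (uhat : nat -> nat -> V),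
      SSC_run F G B tau p phat -> DR_run F G B tau u r uhat ->
      coupled F B (p 0%N) (u 0%N) (r 0%N) ->
      forall (n : nat) (j : 'I_J),
        strong_duality_qualification (B j)
          (DR_smooth_part F (uhat n.+1 j) (r n j)) (G j)) :
  is_dualization F B (DR_method F G B tau) (SSC_method F G B tau) /\
  (forall (p phat : nat -> forall j, dual (W j))
      (u : nat -> V) (r : nat -> 'I_J -> dual V) (uhat : nat -> nat -> V),
    SSC_run F G B tau p phat -> DR_run F G B tau u r uhat ->
    coupled F B (p 0%N) (u 0%N) (r 0%N) ->
    forall n : nat, (1 <= n)%N -> coupled F B (p n) (u n) (r n)).
Proof.
have G_proper j : eproper (@G j) by have [] := hG j.
have track p phat u r uhat :
    SSC_run F G B tau p phat -> DR_run F G B tau u r uhat ->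
    coupled F B (p 0%N) (u 0%N) (r 0%N) ->
    forall n, coupled F B (p n) (u n) (r n).
  move=> ssc dr c0; elim=> [//|n].
  apply: (coupledS G_proper F_diff F_strong F_smooth ssc dr) => j.
  exact: (hqual_loc _ _ _ _ _ ssc dr c0 n j).
split; last first.
  move=> p phat u r uhat ssc dr c0 n _; exact: (track _ _ _ _ _ ssc dr c0 n).
move=> c; exists (conj_deriv F (- adjoint_sum B c),
  fun j => - adjoint (B j) (c j)).
split.
  have [u [r [uhat [u0 r0 dr]]]] := DR_run_exists tau hsolv
    (conj_deriv F (- adjoint_sum B c)) (fun j => - adjoint (B j) (c j)).
  by exists u, r, uhat.
move=> p u [phat [p0 ssc]] [r [uhat [u0 r0 dr]]] n _.
have c0 : coupled F B (p 0%N) (u 0%N) (r 0%N) by rewrite p0 u0 r0.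
have [uE _] := track _ _ _ _ _ ssc dr c0 n.
rewrite subdifferential_fderiv//; split=> //=.
by rewrite uE fderiv_conj_deriv.
Qed.
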